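(* Let $p$ be a Fermat prime, so that $p = 2^f + 1$ for some positive integer $f$. Then there exists a finite solvable group $G$ with $b(G) = 2^{2f}$ and $|G : O_2(G)|_2 = 2^{2f+1}$.
   Context: All groups are finite. $\mathrm{Irr}(G)$ is the set of irreducible complex characters of $G$, and $b(G) = \max\{\chi(1) \mid \chi \in \mathrm{Irr}(G)\}$ is the largest irreducible character degree of $G$. $O_2(G)$ is the largest normal $2$-subgroup of $G$. For a positive integer $m$, $m_2$ is the largest power of $2$ dividing $m$; thus $|G:O_2(G)|_2$ is the $2$-part of the index. *)

(* Defs.v *)
From mathcomp Require Import all_boot all_order all_algebra.
From mathcomp Require Import all_fingroup all_solvable all_field all_character.

Set Implicit Arguments.
Unset Strict Implicit.
Unset Printing Implicit Defensive.

Import Order.TTheory GRing.Theory Num.Theory.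
Local Open Scope ring_scope.

Definition fermat_prime (p : nat) : Prop :=
  prime p /\ exists n : nat, p = (2 ^ (2 ^ n) + 1)%N.

(* Characters take values in algC, so the degree is read back as a natural    *)
(* number with Num.truncn; this is exact, see max_irr_degreeP.                *)
Definition max_irr_degree (gT : finGroupType) (G : {group gT}) : nat :=
  (\max_(i : Iirr G) Num.truncn ('chi[G]_i 1%g)%R)%N.

Lemma max_irr_degreeP (gT : finGroupType) (G : {group gT}) :
  (exists i : Iirr G, 'chi[G]_i 1%g = (max_irr_degree G)%:R)
  /\ (forall i : Iirr G, 'chi[G]_i 1%g <= (max_irr_degree G)%:R).
Proof.
have natK (i : Iirr G) : (Num.truncn ('chi[G]_i 1%g))%:R = 'chi_i 1%g.
  by apply: truncnK; apply: Cnat_irr1.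
split=> [|i].
  have [|i0 defb] :=
    @bigop.eq_bigmax (Iirr G) (fun i => Num.truncn ('chi[G]_i 1%g)).
    by apply/card_gt0P; exists 0.
  by exists i0; rewrite -natK /max_irr_degree defb.
by rewrite -natK ler_nat; apply: (bigop.leq_bigmax i).
Qed.

(* Main.v *)
From HB Require Import structures.
Require Import Defs.
From mathcomp Require Import all_boot all_order all_algebra.
From mathcomp Require Import all_fingroup all_solvable all_field all_character.

Set Implicit Arguments.
Unset Strict Implicit.
Unset Printing Implicit Defensive.

Import Order.TTheory GRing.Theory Num.Theory GroupScope.
Local Open Scope ring_scope.

(** The group is the wreath product G of A = AGL(1, p) with the group of order
    two: the semidirect product of A x A with the involution that swaps the two
    factors.

    The group A is a Frobenius group of order p (p - 1), with kernel the p
    translations and complement the p - 1 = 2 ^ f homotheties. All its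
    irreducible characters are linear but one, of degree 2 ^ f
    [isolated_degree_Frobenius]. Hence A x A has exactly one irreducible
    character of degree 2 ^ (2 f), and the others have degree at most 2 ^ f
    [isolated_degree_dprod]. In G, where A x A has index 2, every
    irreducible character over the exceptional one restricts to it, and the
    characters over the others have degree at most 2 ^ (f + 1) <= 2 ^ (2 f)
    [max_irr_degree_index2]. Therefore b(G) = 2 ^ (2 f).

    The p ^ 2 pairs of translations form a normal p-subgroup V of G, of index
    2 ^ (2 f + 1). This makes G solvable, and V contains its own centralizer
    because the translations do so in A and nothing outside A x A centralizes
    V [wr_base_cent]. As p is odd, O_2(G) is trivial [pcore_trivial_selfcent], so
    that the 2-part of its index is that of |G| = p ^ 2 * 2 ^ (2 f + 1). *)

(** * Isolated degrees *)

(** The degree m is attained exactly once, and a gap separates it from the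
    bound r on all the other degrees, provided that r < m. Multiplicity one is
    what forces the character of degree m to be invariant under every
    overgroup that normalizes G. *)
Definition isolated_degree (gT : finGroupType) (G : {group gT}) (m r : nat) :=
  exists2 k : Iirr G, 'chi_k 1%g = m%:R
    & forall j : Iirr G, j != k -> 'chi_j 1%g <= r%:R.

Section Isolated.

Variable gT : finGroupType.
Implicit Types G H K L : {group gT}.

Lemma irr1_le_constt_Res G H (i : Iirr G) (j : Iirr H) :
    H \subset G -> j \in irr_constt ('Res[H] 'chi_i) ->
  'chi_i 1%g <= #|G : H|%:R * 'chi_j 1%g.
Proof.
move=> sHG; rewrite -constt_Ind_Res => /char1_ge_constt.
by rewrite cfInd1 //; apply; rewrite cfInd_char ?irr_char.
Qed.

(** A character of G that is not trivial on K is induced from a character of K,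
    which is linear because K is abelian, so it has degree |G : K| = |H|; the
    others factor through G / K, which is isomorphic to H, and are linear with
    squares of degrees adding up to |H|. As |G| = |H| + |H| ^ 2, the sum of all
    squares leaves room for only one character of degree |H|. *)
Lemma isolated_degree_Frobenius G K H :
    [Frobenius G = K ><| H] -> abelian K -> abelian H -> (#|H| = #|K|.-1)%N ->
  isolated_degree G #|H| 1.
Proof.
move=> frobG abK abH oH; have frobGK := FrobeniusWker frobG.
have [defG ntK _ _ _] := Frobenius_context frobG.
have [nsKG _ _ _ _] := sdprod_context defG.
have iGK : (#|G : K| = #|H|)%N by rewrite -(index_sdprod defG).
have degInd j : ~~ (K \subset cfker 'chi[G]_j) -> 'chi_j 1%g = #|H|%:R.
  case/(Frobenius_Ind_irrP frobGK)=> i _ ->.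
  rewrite cfInd1 ?normal_sub // iGK lin_char1 ?mulr1 //.
  exact/char_abelianP.
have degLin j : K \subset cfker 'chi[G]_j -> 'chi_j 1%g = 1.
  move=> kerK; apply: lin_char1; rewrite lin_irr_der1.
  apply: subset_trans kerK; rewrite der1_min ?normal_norm //.
  by rewrite -(isog_abelian (sdprod_isog defG)).
have [i0 nz_i0] : exists i : Iirr K, i != 0.
  have: (1 < Nirr K)%N by rewrite NirrE classes_gt1.
  by move=> gt1; exists (Ordinal gt1).
have /irrP[k defk] := irr_induced_Frobenius_ker frobGK nz_i0.
have ntk : ~~ (K \subset cfker 'chi_k).
  by apply/(Frobenius_Ind_irrP frobGK); exists i0.
exists k => [|j neq_jk]; first exact: degInd.
have [kerj | ntj] := boolP (K \subset cfker 'chi_j); first by rewrite degLin.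
have: \sum_(i | K \subset cfker 'chi[G]_i) 'chi_i 1%g ^+ 2 = #|H|%:R.
  have := sum_norm_irr_quo (group1 G) nsKG; rewrite morph1.
  under [X in _ = X -> _]eq_bigr => i _ do
    rewrite ger0_norm ?char1_ge0 ?irr_char //.
  move=> <-; rewrite -iGK -card_quotient ?normal_norm // -irr_sum_square.
  by apply: eq_bigr => i _; rewrite ger0_norm ?char1_ge0 ?irr_char.
move=> sumLin; have := irr_sum_square G.
rewrite (bigID (fun i => K \subset cfker 'chi_i)) /= sumLin.
(* A second character j of degree #|H| would make the squares exceed #|G|. *)
rewrite (bigD1 k) //= (bigD1 j) ?ntj //= !degInd // -(sdprod_card defG).
set s := \sum_(i | _) _; have s_ge0 : 0 <= s.
  by apply: sumr_ge0 => i _; rewrite exprn_ge0 ?char1_ge0 ?irr_char.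
move=> eqG; have /idPn[] : (#|H| + #|H| ^ 2 + #|H| ^ 2 <= #|K| * #|H|)%N.
  by rewrite -(ler_nat algC) -eqG !natrD !natrX !addrA lerDl.
have H_gt0 := cardG_gt0 H; rewrite -ltnNge.
have -> : (#|K| = #|H|.+1)%N by rewrite oH prednK ?cardG_gt0.
by rewrite mulSn -addnA ltn_add2l mulnn -[ltnLHS]addn0 ltn_add2l expn_gt0 H_gt0.
Qed.

(** The irreducible characters of a direct product are the products of those of
    its factors, and such a product misses the degree m * m as soon as one of
    its two factors has degree at most r. *)
Lemma isolated_degree_dprod G K H m r :
    K \x H = G -> (r <= m)%N ->
    isolated_degree K m r -> isolated_degree H m r ->
  isolated_degree G (m * m) (m * r).
Proof.
move=> defG le_rm [k degk maxk] [h degh maxh].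
have le_m (L : {group gT}) (l : Iirr L) : 'chi_l 1%g = m%:R ->
    (forall j : Iirr L, j != l -> 'chi_j 1%g <= r%:R) ->
    forall j : Iirr L, 'chi_j 1%g <= m%:R.
  move=> degl maxl j; have [-> | /maxl/le_trans-> //] := eqVneq j l.
    by rewrite degl.
  by rewrite ler_nat.
have ge0 (L : {group gT}) (j : Iirr L) : 0 <= 'chi_j 1%g.
  by rewrite char1_ge0 ?irr_char.
exists (dprod_Iirr defG (k, h)) => [|i].
  by rewrite dprod_IirrE cfDprod1 degk degh natrM.
have /codomP[[a b] ->] := dprod_Iirr_onto defG i.
rewrite (inj_eq (@dprod_Iirr_inj _ _ _ _ defG)) dprod_IirrE cfDprod1 xpair_eqE.
rewrite negb_and natrM => /orP[/maxk le_a | /maxh le_b].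
  by rewrite mulrC ler_pM ?(le_m _ h).
by rewrite ler_pM ?(le_m _ k).
Qed.

(** Let i lie over the character j of L. If j is not the isolated character k,
    then the degree of i is at most 2 * r. Since k is invariant in G, a
    character i over k restricts to a multiple e of k by Clifford's theorem, and
    the squared norm e ^ 2 of this restriction is at most |G : L| = 2, so that
    e = 1 and i has degree m. *)
Lemma max_irr_degree_index2 G L m r :
    L <| G -> #|G : L| = 2 -> (2 * r <= m)%N ->
    isolated_degree L m r ->
  max_irr_degree G = m.
Proof.
move=> nsLG iGL le_2r_m [k degk maxk]; have sLG := normal_sub nsLG.
have m_gt0 : (0 < m)%N by rewrite -(ltr0n algC) -degk irr1_gt0.
have lt_rm : (r < m)%N.
  case: (posnP r) => [-> // | r_gt0]; apply: leq_trans le_2r_m.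
  by rewrite mul2n -addnn -[ltnLHS]addn0 ltn_add2l.
have [[i1 def1] max_i1] := max_irr_degreeP G.
have over i : k \in irr_constt ('Res[L] 'chi[G]_i) -> 'chi_i 1%g = m%:R.
  move=> kRi; have := Clifford_Res_sum_cfclass nsLG kRi.
  have -> : \sum_(chi <- ('chi_k ^: G)%CF) chi = 'chi_k.
    rewrite (_ : ('chi_k ^: G)%CF = [:: 'chi_k]) ?big_seq1 //.
    have inv_k y : y \in G -> ('chi_k ^ y)%CF = 'chi_k.
      move=> Gy; rewrite -conjg_IirrE; congr 'chi_(_).
      apply/eqP/negPn/negP => /maxk.
      by rewrite conjg_IirrE cfConjg1 degk ler_nat leqNgt lt_rm.
    apply/perm_small_eq => //; apply: uniq_perm => //; first exact: cfclass_uniq.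
    move=> chi; rewrite inE; apply/cfclassP/eqP => [[y /inv_k-> //] | ->].
    by exists 1%g; rewrite ?group1 ?inv_k.
  set e := '[_, _] => defRes.
  have /natrP[n def_e] : e \in Num.nat.
    by rewrite Cnat_cfdot_char_irr ?cfRes_char ?irr_char.
  have n_gt0 : (0 < n)%N.
    by move: kRi; rewrite irr_consttE -/e def_e pnatr_eq0 lt0n.
  have := cfnorm_Res_leif 'chi_i sLG; rewrite defRes cfnormZ !cfnorm_irr !mulr1.
  rewrite iGL def_e normr_nat -natrX => -[]; rewrite ler_nat => le_n2 _.
  have n1 : n = 1%N.
    apply/eqP; rewrite eqn_leq n_gt0 andbT leqNgt; apply: contraL le_n2 => n_gt1.
    by rewrite -ltnNge (leq_trans (isT : 2 < 2 ^ 2)%N) ?leq_sqr.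
  by rewrite -(cfRes1 L) defRes def_e n1 scale1r.
have other i j : j != k -> j \in irr_constt ('Res[L] 'chi[G]_i) ->
    'chi_i 1%g <= m%:R.
  move=> /maxk lejr /(irr1_le_constt_Res sLG)/le_trans-> //.
  rewrite iGL (le_trans (ler_wpM2l _ lejr)) ?ler0n //.
  by rewrite -natrM ler_nat.
apply/eqP; rewrite eqn_leq -!(ler_nat algC); apply/andP; split.
  rewrite -def1; have /neq0_has_constt[j jRi] := Res_irr_neq0 L i1.
  have [eq_jk | /other-> //] := eqVneq j k.
  by rewrite over // -eq_jk.
have [i] := constt_cfInd_irr k sLG.
by rewrite constt_Ind_Res => /over <-.
Qed.

End Isolated.

Lemma isolated_degree_isog (aT rT : finGroupType) (G : {group aT})
    (R : {group rT}) m r :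
  G \isog R -> isolated_degree G m r -> isolated_degree R m r.
Proof.
case/isogP=> f injf defR; have isoG : isom G R f by apply/isomP.
case=> k degk maxk; exists (isom_Iirr isoG k) => [|j].
  by rewrite isom_IirrE cfIsom1.
rewrite -[j](isom_IirrKV isoG) (inj_eq (isom_Iirr_inj isoG)) => /maxk.
by rewrite [in X in _ -> X]isom_IirrE cfIsom1.
Qed.

(** * Trivial cores *)

(** The pi-core and L are normal subgroups of coprime orders, hence commute
    elementwise. The pi-core therefore lies in L, which it meets trivially. *)
Lemma pcore_trivial_selfcent (gT : finGroupType) (pi : nat_pred)
    (G L : {group gT}) :
    L <| G -> pi^'.-group L -> 'C_G(L) \subset L -> 'O_pi(G) = 1%g.
Proof.
move=> nsLG pi'L cLL; have [sLG nLG] := andP nsLG.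
have tiOL : 'O_pi(G) :&: L = 1%g.
  by rewrite coprime_TIg // (pnat_coprime (pcore_pgroup pi G)).
apply/trivgP; rewrite -tiOL subsetI subxx (subset_trans _ cLL) //.
rewrite subsetI pcore_sub; apply/commG1P/trivgP; rewrite -tiOL commg_subI //.
  by rewrite subsetI subxx (subset_trans (pcore_sub _ _)).
by rewrite subsetI subxx (subset_trans sLG) ?gFnorm.
Qed.

(** * The wreath product of a group with the group of order two *)

Section Wreath.

Variable gT : finGroupType.

(** The pair (x, s) stands for the product of the base element x with the s-th
    power of the involution that swaps the two coordinates. *)
Definition wreath2 : Type := (gT * gT * bool)%type.
HB.instance Definition _ := Finite.on wreath2.

Implicit Types (u v w : wreath2) (s : bool) (x y : gT * gT) (P : {group gT}).

Definition swap_if s x := if s then (x.2, x.1) else x.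
Definition wr_one : wreath2 := (1%g, false).
Definition wr_mul u v : wreath2 := ((u.1 * swap_if u.2 v.1)%g, u.2 (+) v.2).
Definition wr_inv u : wreath2 := (swap_if u.2 u.1^-1%g, u.2).

Lemma swap_ifM s : {morph swap_if s : x y / (x * y)%g}.
Proof. by case: s. Qed.

Lemma swap_if_add s t x : swap_if (s (+) t) x = swap_if s (swap_if t x).
Proof. by case: s t x => [] [] []. Qed.

Lemma wr_mulA : associative wr_mul.
Proof.
by move=> u v w; rewrite /wr_mul /= swap_ifM swap_if_add mulgA addbA.
Qed.

Lemma wr_mul1 : left_id wr_one wr_mul.
Proof. by case=> x s; rewrite /wr_mul /= mul1g. Qed.

Lemma wr_mulV : left_inverse wr_one wr_inv wr_mul.
Proof. by case=> x s; rewrite /wr_mul /= -swap_ifM mulVg addbb; case: s. Qed.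

HB.instance Definition _ := Finite_isGroup.Build wreath2 wr_mulA wr_mul1 wr_mulV.

Definition wr_base x : wreath2 := (x, false).

Lemma wr_baseM : {in setT &, {morph wr_base : x y / (x * y)%g}}.
Proof. by []. Qed.

Canonical wr_base_morphism := Morphism wr_baseM.

Lemma injm_wr_base : 'injm wr_base.
Proof. by apply/injmP=> x y _ _ []. Qed.

Lemma mem_wr_base (A : {set gT * gT}) u :
  (u \in wr_base @* A) = ~~ u.2 && (u.1 \in A).
Proof.
apply/morphimP/idP => [[x _ Ax ->] // | ].
by case: u => x [] //= Ax; exists x; rewrite ?inE.
Qed.

Lemma wr_base_conj x u : (wr_base x ^ u)%g = wr_base (swap_if u.2 (x ^ u.1)%g).
Proof.
case: u => y s; rewrite conjgE conjgE !swap_ifM.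
by rewrite [LHS]/(wr_mul _ (wr_mul _ _)) /wr_mul /= addbb swap_ifM.
Qed.

Lemma wr_base_normal P :
  P <| [set: gT] -> wr_base @* setX P P <| [set: wreath2].
Proof.
case/andP=> _ /subsetP nP; rewrite /normal subsetT; apply/subsetP=> u _.
rewrite inE; apply/subsetP=> _ /imsetP[_ /morphimP[x _ Px ->] ->].
rewrite wr_base_conj mem_wr_base /=.
case: x u Px => [a b] [[c d] s]; rewrite /swap_if inE /= => /andP[Pa Pb].
have nPx e g : e \in P -> (e ^ g)%g \in P.
  by move=> Pe; rewrite memJ_norm ?nP ?inE.
by case: s; rewrite inE /= !nPx.
Qed.

(** An element that swaps the coordinates cannot commute with (z, 1) when z is
    not trivial; an element (c, d) of the base commutes with all of P x P only
    if both c and d centralize P. *)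
Lemma wr_base_cent P :
    P :!=: 1%g -> 'C(P)%g \subset P ->
  'C(wr_base @* setX P P)%g \subset wr_base @* setX P P.
Proof.
case/trivgPn=> z Pz ntz sCP; apply/subsetP=> u cu.
have {cu}cu a b : a \in P -> b \in P -> commute u (wr_base (a, b)).
  by move=> Pa Pb; apply: (centP cu); rewrite mem_wr_base !inE /= Pa.
rewrite mem_wr_base; case: u cu => [[c d] s] cu /=.
have s0 : s = false.
  case: s cu => // /(_ z 1%g Pz (group1 P)) [/= _ /eqP].
  by rewrite mul1g -[X in _ == X]mulg1 (inj_eq (mulgI _)) (negPf ntz).
rewrite {}s0 in cu *; rewrite /= inE /=; apply/andP; split.
  apply: (subsetP sCP); apply/centP=> a Pa.
  by have [] := cu a 1%g Pa (group1 P).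
apply: (subsetP sCP); apply/centP=> a Pa.
by have [] := cu 1%g a (group1 P) Pa.
Qed.

Lemma card_wreath2 : #|[set: wreath2]| = (2 * #|gT| ^ 2)%N.
Proof. by rewrite cardsT !card_prod card_bool mulnC mulnn. Qed.

Lemma wr_base_index2 : #|[set: wreath2] : wr_base @* setT| = 2.
Proof.
apply/eqP; rewrite -(eqn_pmul2l (cardG_gt0 (wr_base @* setT)%G)).
rewrite Lagrange ?subsetT //.
by rewrite card_wreath2 card_injm ?injm_wr_base // cardsT card_prod mulnC mulnn.
Qed.

(** The bound m > 1 is what keeps the characters induced from the base, of
    degree at most 2 * m, below m * m. *)
Lemma max_irr_degree_wreath2 m :
    (1 < m)%N -> isolated_degree [set: gT] m 1 ->
  max_irr_degree [set: wreath2] = (m * m)%N.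
Proof.
move=> m_gt1 isoT; have m_gt0 := ltnW m_gt1.
have nB : wr_base @* setT <| [set: wreath2].
  have := wr_base_normal (normal_refl [set: gT]).
  by rewrite (_ : setX _ _ = setT) //; apply/setP=> x; rewrite !inE.
have iso1 : isolated_degree (setX [set: gT] (1%G : {group gT})) m 1.
  exact: isolated_degree_isog (isog_setX1 _ _) isoT.
have iso2 : isolated_degree (setX (1%G : {group gT}) [set: gT]) m 1.
  exact: isolated_degree_isog (isog_set1X _ _) isoT.
have isoX := isolated_degree_dprod (setX_dprod _ _) m_gt0 iso1 iso2.
have isoB : isolated_degree (wr_base @* setX setT setT) (m * m) (m * 1).
  by apply: isolated_degree_isog isoX; rewrite sub_isog ?subsetT ?injm_wr_base.
have eqX : setX [set: gT] [set: gT] = setT by apply/setP=> x; rewrite !inE.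
apply: max_irr_degree_index2 isoB; rewrite /= ?eqX ?wr_base_index2 //.
by rewrite muln1 mulnC leq_pmul2l.
Qed.

End Wreath.

(** * The affine group of the line over a finite field *)

Section Affine.

Variable F : finFieldType.

Notation affine_act := (FinRing.unit_groupAction F).
Definition affine_group : finGroupType := sdprod_by affine_act.
Definition translations : {group affine_group} := (sdpair1 affine_act @* setT)%G.
Definition homotheties : {group affine_group} := (sdpair2 affine_act @* setT)%G.

Lemma card_translations : #|translations| = #|F|.
Proof. by rewrite card_injm ?injm_sdpair1 // cardsT. Qed.

Lemma card_homotheties : #|homotheties| = #|F|.-1.
Proof. by rewrite card_injm ?injm_sdpair2 // card_finField_unit. Qed.

(** A homothety x |-> x * u fixes a nonzero x only if u = 1. The field with two
    elements is excluded because its group of homotheties is trivial. *)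
Lemma affine_Frobenius :
  (2 < #|F|)%N -> [Frobenius [set: affine_group] = translations ><| homotheties].
Proof.
move=> F_gt2; apply/Frobenius_semiregularP; first exact: sdprod_sdpair.
- by rewrite trivg_card1 card_translations -(subnKC F_gt2).
- by rewrite trivg_card1 card_homotheties -(subnKC F_gt2).
move=> h /setD1P[nth /morphimP[u _ _ defh]].
apply/trivgP/subsetP=> k /setIP[/morphimP[x _ _ ->] /cent1P cxh].
have: sdpair1 affine_act (affine_act x u) = sdpair1 affine_act x.
  by rewrite sdpair_act ?inE // -defh; apply/conjg_fixP/commgP.
move/(injmP (injm_sdpair1 _))=> /(_ (in_setT _) (in_setT _)) /= eq_xu.
have [-> | nzx] := eqVneq x 0%R.
  by rewrite (morph1 (sdpair1_morphism _)) set11.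
case/negP: nth; rewrite defh.
have -> : u = 1%g by apply/val_inj/(mulfI nzx); rewrite mulr1.
by rewrite (morph1 (sdpair2_morphism _)).
Qed.

Lemma isolated_degree_affine :
  (2 < #|F|)%N -> isolated_degree [set: affine_group] #|F|.-1 1.
Proof.
move=> F_gt2; rewrite -card_homotheties.
apply: isolated_degree_Frobenius (affine_Frobenius F_gt2) _ _ _.
- by apply: morphim_abelian; apply: FinRing.zmod_abelian.
- by apply/morphim_abelian/cyclic_abelian; apply: field_unit_group_cyclic.
by rewrite card_homotheties card_translations.
Qed.

(** In a Frobenius group even the centralizer of a single nontrivial element of
    the kernel lies in the kernel. *)
Lemma translations_self_centralizing :
  (2 < #|F|)%N ->
  [/\ translations :!=: 1%g, translations <| [set: affine_group]
    & 'C(translations)%g \subset translations].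
Proof.
move=> F_gt2; have frobA := FrobeniusWker (affine_Frobenius F_gt2).
have [ntT _ nsT regT] := Frobenius_kerP frobA.
split=> //; have [t Tt ntt] := trivgPn _ ntT; apply: subset_trans (regT t _).
  by rewrite setTI -cent_set1 centS ?sub1set.
by rewrite !inE ntt.
Qed.

Lemma card_affine : #|affine_group| = (#|F| * #|F|.-1)%N.
Proof.
have := sdprod_card (sdprod_sdpair affine_act).
by rewrite cardsT -card_homotheties -card_translations.
Qed.

End Affine.

(** * The example attached to a Fermat prime *)

Theorem theorem6 (p f : nat) (hp : fermat_prime p)
    (hf : (0 < f)%N) (hpf : p = (2 ^ f + 1)%N) :
  exists (gT : finGroupType) (G : {group gT}),
    [/\ solvable G,
        max_irr_degree G = (2 ^ (2 * f))%N
      & (#|G : 'O_2(G)|%g`_2)%N = (2 ^ (2 * f + 1))%N].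
Proof.
case: hp => p_pr _; pose F : finFieldType := 'F_p.
have oF : #|F| = p by rewrite card_Fp.
have oF1 : #|F|.-1 = (2 ^ f)%N by rewrite oF hpf addn1.
have F_gt2 : (2 < #|F|)%N.
  by rewrite oF hpf addn1 ltnS -{1}(expn1 2) leq_exp2l.
have [ntT nsT sCT] := translations_self_centralizing F_gt2.
set T := translations F in ntT nsT sCT.
pose G := [set: wreath2 (affine_group F)]%G.
pose V := (wr_base (gT:=affine_group F) @* setX T T)%G.
have nsVG : V <| G by apply: wr_base_normal.
have oV : #|V| = (p ^ 2)%N.
  rewrite card_injm ?injm_wr_base ?subsetT // cardsX.
  by rewrite card_translations oF mulnn.
have oG : #|G| = (p ^ 2 * 2 ^ (2 * f + 1))%N.
  rewrite card_wreath2 card_affine oF1 oF.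
  by rewrite expnMn -expnM mulnCA -expnS addn1 [(f * 2)%N]mulnC.
have p_odd : odd p by rewrite hpf addn1 /= oddX orbF -lt0n hf.
exists _, G; split.
- rewrite (series_sol nsVG) (pgroup_sol (p := p)) ?(pgroup_sol (p := 2)) //.
    rewrite /pgroup card_quotient ?normal_norm // -divgS ?normal_sub //.
    by rewrite oG oV mulKn ?expn_gt0 ?prime_gt0 // pnatX pnat_id.
  by rewrite /pgroup oV pnatX pnat_id.
- rewrite mulnC expnM -mulnn; apply: max_irr_degree_wreath2.
    by rewrite -{1}(expn0 2) ltn_exp2l.
  by rewrite -oF1; apply: isolated_degree_affine.
rewrite (pcore_trivial_selfcent nsVG).
- rewrite indexg1 oG partnM ?expn_gt0 ?prime_gt0 //.
  rewrite [X in (_ * X)%N]part_pnat_id ?pnatX ?pnat_id //.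
  by rewrite part_p'nat ?mul1n // pnatX orbC p'natE // dvdn2 p_odd.
- by rewrite /pgroup oV pnatX orbC p'natE // dvdn2 p_odd.
by rewrite setTI wr_base_cent.
Qed.
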